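(* Let $G=(V,E,w)$ be a finite undirected graph with nonnegative edge weights and $\mathrm{Vol}(G)>0$, and let $0\le \mu\le 1/2$. Assume there exists a set $S\subset V$ with $\mu\,\mathrm{Vol}(G)\le \mathrm{Vol}(S)\le (1-\mu)\mathrm{Vol}(G)$. Then \[ 2\phi_\mu \;\ge\; \lambda_\mu \;\ge\; \frac12 \max\left\{ \min\left\{ \left(\frac{\mu}{1-\mu}\phi_\mu\right)^2,\ \left(\frac{\mu^2\phi_\mu+(1-2\mu)\phi_0}{1-\mu-\mu^2}\right)^2\right\},\ \phi_0^2\right\}, \] where $\phi_\mu$, $\phi_0$ and $\lambda_\mu$ are defined in the context.
   Context: For a vertex $v$, its degree is $d(v)=\sum_{u\in V} w(v,u)$ (with $w(v,u)=0$ if $vu\notin E$), $\vec d\in\mathbb{R}^V$ is the degree vector and $D$ is the diagonal degree matrix. For $S\subseteq V$, $\mathrm{Vol}(S)=\sum_{v\in S} d(v)$, $\mathrm{Vol}(G)=\mathrm{Vol}(V)$, $\bar S=V\setminus S$, and $|\partial S|=\sum_{u\in S, v\in\bar S} w(u,v)$. The conductance of $S$ (with $\mathrm{Vol}(S),\mathrm{Vol}(\bar S)>0$) is $\phi(S)=|\partial S|/\min\{\mathrm{Vol}(S),\mathrm{Vol}(\bar S)\}$. The $\mu$-conductance is \[ \phi_\mu=\min\{\phi(S): S\subset V,\ \mu\,\mathrm{Vol}(G)\le \mathrm{Vol}(S)\le(1-\mu)\mathrm{Vol}(G)\}, \] and $\phi_0$ is this quantity with $\mu=0$, i.e. the ordinary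 conductance $\min_S\phi(S)$ of $G$. The Laplacian $L=\sum_{uv\in E} w(u,v)(\mathbf 1_u-\mathbf 1_v)(\mathbf 1_u-\mathbf 1_v)^T$, so $x^TLx=\sum_{uv\in E}w(u,v)(x_u-x_v)^2$. Define \[ \lambda_\mu=\min_{x\in\mathbb{R}^V}\ x^TLx \quad\text{subject to}\quad x^T\vec d=0,\ \ x^TDx=1,\ \ \|x\|_\infty\le\sqrt{\tfrac{1-\mu}{\mu\,\mathrm{Vol}(G)}},\ \ |x_i|\ge\sqrt{\tfrac{\mu}{(1-\mu)\mathrm{Vol}(G)}}\ \ \forall i\in V. \] For $\mu=0$ the last two constraints are vacuous, so $\lambda_0$ is the usual spectral relaxation $\min\{x^TLx/x^TDx: x^T\vec d=0\}$. *)

(* Defs.v *)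
From HB Require Import structures.
From mathcomp Require Import all_boot all_order all_algebra.
From mathcomp Require Import boolp classical_sets reals.

Set Implicit Arguments.
Unset Strict Implicit.
Unset Printing Implicit Defensive.

Import Order.TTheory GRing.Theory Num.Theory.
Local Open Scope classical_set_scope.
Local Open Scope ring_scope.

Definition is_min (R : realType) (A : set R) (m : R) : Prop :=
  A m /\ lbound A m.

(* The value is meaningful only when [A] has a least element (see [set_minE]);
   otherwise it is the junk value 0, not the infimum. *)
Definition set_min (R : realType) (A : set R) : R := xget 0 (is_min A).

Lemma set_minE (R : realType) (A : set R) (m : R) :
  is_min A m -> set_min A = m.
Proof.
move=> [Am lm]; apply: xget_unique => [|y [Ay ly]]; first by split.
by apply/eqP; rewrite eq_le (ly _ Am) (lm _ Ay).
Qed.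

(* Simple graph: no loops, so that [0 < Vol G] yields two distinct vertices of
   positive degree. *)
Record wgraph (R : realType) (V : finType) := WGraph {
  edge : rel V;
  weight : V -> V -> R;
  edge_sym : symmetric edge;
  edge_irrefl : irreflexive edge;
  weight_sym : forall u v, weight u v = weight v u;
  weight_ge0 : forall u v, 0 <= weight u v;
  weight_nedge : forall u v, ~~ edge u v -> weight u v = 0
}.

Section Graph.
Variables (R : realType) (V : finType) (G : wgraph R V).

Definition degree (v : V) : R := \sum_(u : V) weight G v u.

Definition vol (S : {set V}) : R := \sum_(v in S) degree v.

Definition volG : R := vol [set: V]%SET.

Definition boundary (S : {set V}) : R :=
  \sum_(u in S) \sum_(v in ~: S) weight G u v.

Definition conductance (S : {set V}) : R :=
  boundary S / Num.min (vol S) (vol (~: S)%SET).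

Definition balanced (mu : R) (S : {set V}) : Prop :=
  mu * volG <= vol S /\ vol S <= (1 - mu) * volG.

(* The two positivity conditions are the domain of definition of
   [conductance]; they are implied by [balanced] when [0 < mu]. *)
Definition mu_conductance (mu : R) : R :=
  set_min [set conductance S | S in
    [set S : {set V} | [/\ balanced mu S, 0 < vol S & 0 < vol (~: S)%SET]]].

Definition indic (a : V) (u : V) : R := (u == a)%:R.

(* Every unordered edge occurs twice, with the same contribution, in the sum
   over ordered pairs; hence the factor 1/2. *)
Definition laplacian (u v : V) : R :=
  2^-1 * \sum_(a : V) \sum_(b : V | edge G a b)
    weight G a b * ((indic a u - indic b u) * (indic a v - indic b v)).

Definition degree_mx (u v : V) : R := if u == v then degree u else 0.

Definition qform (M : V -> V -> R) (x : V -> R) : R :=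
  \sum_(u : V) \sum_(v : V) x u * M u v * x v.

Definition norm_inf (x : V -> R) : R := \big[Num.max/0]_(v : V) `|x v|.

(* For [mu = 0] the upper bound is 1/0 = +oo and the lower bound is 0, so both
   entrywise constraints are vacuous; the guard [0 < mu] is needed because
   [_ / 0] is 0 in MathComp. *)
Definition feasible (mu : R) (x : V -> R) : Prop :=
  [/\ \sum_(v : V) x v * degree v = 0,
      qform degree_mx x = 1,
      0 < mu -> norm_inf x <= Num.sqrt ((1 - mu) / (mu * volG)) &
      forall v : V, Num.sqrt (mu / ((1 - mu) * volG)) <= `|x v| ].

Definition lambda (mu : R) : R :=
  set_min [set qform laplacian x | x in [set x : V -> R | feasible mu x]].

End Graph.

(* Main.v *)
(* Upper bound: the two-valued vector orthogonal to the degrees attached to an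
   optimal balanced set is feasible.

   Lower bound: let [x] be feasible, with [a <= |x| <= b] entrywise, and replace
   [x] by [-x] if necessary so that its weighted median [c] is nonnegative. The
   orthogonality to the degrees and [a / b = mu / (1 - mu)] make [x < 0] a set
   of volume at least [mu Vol]. Hence every threshold of [x] between [-a] and
   [c] cuts off a balanced set, whose boundary is controlled by [phi_mu]; for
   the other thresholds [phi_0] is used. Applying this to the level sets of
   [z = y |y|], where [y = x - c], and Cauchy-Schwarz as in the proof of
   Cheeger's inequality gives [lambda_mu >= K^2 / 2] with
   [K = phi_0 + 4 mu^2 (phi_mu - phi_0)], which dominates both [phi_0] and
   [(mu^2 phi_mu + (1 - 2 mu) phi_0) / (1 - mu - mu^2)]. *)

Require Import Defs.
From HB Require Import structures.
From mathcomp Require Import all_boot all_order all_algebra.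
From mathcomp Require Import boolp classical_sets reals.
From mathcomp Require Import topology function_spaces normedtype derive.
From mathcomp Require Import ring lra.

Set Implicit Arguments.
Unset Strict Implicit.
Unset Printing Implicit Defensive.

Import Order.TTheory GRing.Theory Num.Theory.
Local Open Scope ring_scope.

Section Cheeger.
Variables (R : realType) (V : finType) (G : wgraph R V).
Implicit Types (x y z : V -> R) (S T : {set V}) (mu c t K M : R).

Local Notation w := (weight G).
Local Notation d := (degree G).
Local Notation vol := (vol G).
Local Notation volG := (volG G).
Local Notation boundary := (boundary G).
Local Notation L := (laplacian G).

(** * Volume, boundary, total variation and Laplacian energy *)

(** The l1 counterpart of the Laplacian energy; again 1/2 compensates for counting each edge in both
    orders. *)
Definition total_variation x : R := 2^-1 * \sum_u \sum_v w u v * `|x u - x v|.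

Lemma degree_ge0 v : 0 <= d v.
Proof. by apply: sumr_ge0 => u _; exact: weight_ge0. Qed.

Lemma weight_le_degree u v : w u v <= d u.
Proof.
rewrite /degree (bigD1 v) //= lerDl.
by apply: sumr_ge0 => i _; exact: weight_ge0.
Qed.

Lemma vol_ge0 S : 0 <= vol S.
Proof. by apply: sumr_ge0 => v _; exact: degree_ge0. Qed.

Lemma vol_setC S : vol S + vol (~: S)%SET = volG.
Proof.
rewrite /Defs.volG /Defs.vol [RHS](bigID (mem S)) /=; congr (_ + _).
  by apply: eq_bigl => v; rewrite inE.
by apply: eq_bigl => v; rewrite !inE.
Qed.

Lemma vol_subset S T : S \subset T -> vol S <= vol T.
Proof.
move=> /fintype.subsetP ST; rewrite /Defs.vol [leRHS](bigID (mem S)) /=.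
have -> : \sum_(v in T | v \in S) d v = \sum_(v in S) d v.
  by apply: eq_bigl => v; case: (boolP (v \in S)) => [/ST ->|_]; rewrite ?andbF.
by rewrite lerDl; apply: sumr_ge0 => v _; exact: degree_ge0.
Qed.

Lemma vol_set0 : vol finset.set0 = 0.
Proof. by rewrite /Defs.vol big_set0. Qed.

Lemma vol_indicator S : vol S = \sum_v d v * (v \in S)%:R.
Proof.
rewrite /Defs.vol big_mkcond; apply: eq_bigr => v _.
by case: (v \in S); rewrite ?mulr1 ?mulr0.
Qed.

Lemma boundary_ge0 S : 0 <= boundary S.
Proof.
by apply: sumr_ge0 => u _; apply: sumr_ge0 => v _; exact: weight_ge0.
Qed.

Lemma degree_sum_sym x :
  \sum_u \sum_v w u v * (x u + x v) = 2 * \sum_u d u * x u.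
Proof.
have E : \sum_u \sum_v w u v * x u = \sum_u d u * x u.
  by apply: eq_bigr => u _; rewrite -mulr_suml.
rewrite mulr2n mulrDl mul1r -{1}E -E [X in _ = _ + X]exchange_big /= -big_split.
apply: eq_bigr => u _; rewrite -big_split; apply: eq_bigr => v _ /=.
by rewrite mulrDr (weight_sym G v u).
Qed.

Lemma boundaryE S :
  boundary S = total_variation (fun v => (v \in S)%:R).
Proof.
have E : boundary S = \sum_u \sum_v w u v * ((u \in S) && (v \notin S))%:R.
  rewrite /Defs.boundary big_mkcond; apply: eq_bigr => u _.
  case: ifP => _ /=; last by rewrite big1 // => v _; rewrite mulr0.
  rewrite big_mkcond; apply: eq_bigr => v _; rewrite inE.
  by case: (v \in S); rewrite /= ?mulr0 ?mulr1.
have two : (2 : R) != 0 by rewrite pnatr_eq0.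
(* After doubling, the sum and its copy with [u] and [v] exchanged together count each cut edge in
   both orders. *)
apply: (mulfI two); rewrite /total_variation mulVKf //.
rewrite mulr2n mulrDl mul1r {1}E E [X in _ + X = _]exchange_big /= -big_split.
apply: eq_bigr => u _; rewrite -big_split; apply: eq_bigr => v _ /=.
rewrite (weight_sym G v u) -mulrDr; congr (_ * _).
by case: (u \in S); case: (v \in S);
  rewrite /= ?subrr ?subr0 ?sub0r ?normrN ?normr0 ?normr1 ?addr0 ?add0r.
Qed.

Lemma total_variation_ge0 x : 0 <= total_variation x.
Proof.
rewrite mulr_ge0 ?invr_ge0 //; apply: sumr_ge0 => u _; apply: sumr_ge0 => v _.
by rewrite mulr_ge0 ?weight_ge0.
Qed.

Lemma degree_mx_qform x : qform (degree_mx G) x = \sum_v d v * x v ^+ 2.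
Proof.
apply: eq_bigr => u _; rewrite (bigD1 u) //= /degree_mx eqxx big1 ?addr0.
  by rewrite mulrAC -expr2 mulrC.
by move=> v; rewrite eq_sym => /negPf ->; rewrite mulr0 mul0r.
Qed.

Lemma laplacian_qform x :
  qform L x = 2^-1 * \sum_u \sum_v w u v * (x u - x v) ^+ 2.
Proof.
have ind a : \sum_u x u * indic R a u = x a.
  rewrite (bigD1 a) //= /indic eqxx mulr1 big1 ?addr0 // => v /negPf ->.
  by rewrite mulr0.
have dif a b : \sum_u x u * (indic R a u - indic R b u) = x a - x b.
  by under eq_bigr do rewrite mulrBr; rewrite sumrB !ind.
have LE u v : L u v = \sum_(q : V * V) 2^-1 * (w q.1 q.2 *
    ((indic R q.1 u - indic R q.2 u) * (indic R q.1 v - indic R q.2 v))).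
  rewrite /laplacian -mulr_sumr; congr (_ * _).
  rewrite -(pair_bigA _ (fun a b =>
    w a b * ((indic R a u - indic R b u) * (indic R a v - indic R b v)))) /=.
  apply: eq_bigr => a _; rewrite big_mkcond; apply: eq_bigr => b _.
  by case: ifPn => // /weight_nedge ->; rewrite mul0r.
(* With the sum over edges outermost, the double sum over [u], [v] factors into the square of
   [x a - x b]. *)
rewrite /qform pair_bigA [in RHS]pair_bigA /=.
under eq_bigr => p _.
  rewrite LE mulr_sumr mulr_suml; over.
rewrite exchange_big mulr_sumr /=; apply: eq_bigr => -[a b] _ /=.
rewrite expr2 -{1}dif -dif mulr_suml !mulr_sumr.
under [RHS]eq_bigr do rewrite !mulr_sumr.
rewrite [RHS]pair_bigA /=; apply: eq_bigr => -[u v] _ /=; ring.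
Qed.

(* Peeling off the lowest level of [z], i.e. subtracting its least positive
   value from it on its support, shrinks the support. *)
Lemma layer_cake K z : (forall v, 0 <= z v) ->
  (forall t, 0 <= t ->
     K * vol [set v | t < z v]%SET <= boundary [set v | t < z v]%SET) ->
  K * \sum_v d v * z v <= total_variation z.
Proof.
have [n] := ubnP #|[set v | 0 < z v]%SET|.
elim: n z => // n IH z; rewrite ltnS => cardz z0 cut.
set T := [set v | 0 < z v]%SET.
have [T0|[v0 v0T]] := set_0Vmem T.
  rewrite big1 ?mulr0 ?total_variation_ge0 // => v _.
  have : v \notin T by rewrite T0 inE.
  by rewrite inE lt_neqAle z0 andbT negbK => /eqP <-; rewrite mulr0.
pose v1 := [arg min_(v < v0 in T) z v]%O.
have [v1T v1min] : v1 \in T /\ {in T, forall v, z v1 <= z v}.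
  by rewrite /v1; case: arg_minP.
set m := z v1; have m0 : 0 < m by move: v1T; rewrite inE.
have zT v : v \notin T -> z v = 0.
  by rewrite inE lt_neqAle z0 andbT negbK => /eqP <-.
pose z' v := z v - m * (v \in T)%:R.
have z'0 v : 0 <= z' v.
  rewrite /z'; have [/v1min|/zT ->] := boolP (v \in T).
    by rewrite mulr1 subr_ge0.
  by rewrite mulr0 subr0.
(* Superlevel sets of [z'] are superlevel sets of [z] at a level raised by [m], so [z'] inherits the
   hypothesis on cuts. *)
have z'lt t v : 0 <= t -> (t < z' v) = (t + m < z v).
  move=> t0; rewrite /z'; have [_|/zT ->] := boolP (v \in T).
    by rewrite mulr1 ltrBrDr.
  by rewrite mulr0 subr0 !ltNge t0 addr_ge0 // ltW.
have {}IH : K * \sum_v d v * z' v <= total_variation z'.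
  apply: IH => // [|t t0].
    apply: leq_trans cardz; apply: proper_card; apply/properP; split.
      apply/fintype.subsetP => v; rewrite !inE z'lt // add0r; exact: lt_trans.
    by exists v1 => //; rewrite inE z'lt // add0r ltxx.
  have -> : [set v | t < z' v]%SET = [set v | t + m < z v]%SET.
    by apply/setP => v; rewrite !inE z'lt.
  by apply: cut; rewrite addr_ge0 // ltW.
(* Variation is additive here because [z'] and [m] times the indicator of [T] never vary in opposite
   directions along an edge: both vanish off [T], and on [T] the second is constant. *)
have -> : total_variation z = total_variation z' + m * boundary T.
  rewrite boundaryE /total_variation mulrCA -mulrDr; congr (_ * _).
  rewrite mulr_sumr -big_split; apply: eq_bigr => u _ /=.
  rewrite mulr_sumr -big_split; apply: eq_bigr => v _ /=.
  rewrite mulrCA -mulrDr; congr (_ * _).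
  have := z'0 u; have := z'0 v; rewrite /z'.
  have [_|/zT ->] := boolP (u \in T); have [_|/zT ->] := boolP (v \in T).
  - by move=> _ _; rewrite !mulr1 subrr normr0 mulr0 addr0; congr `|_|; ring.
  - move=> _; rewrite /= !(mulr0, mulr1, subr0) => h.
    by rewrite normr1 mulr1 !ger0_norm ?subrK ?z0.
  - move=> + _; rewrite /= !(mulr0, mulr1, subr0) => h.
    rewrite !sub0r !normrN normr1 mulr1 !ger0_norm ?subrK ?z0 //.
  - by move=> _ _; rewrite /= !(mulr0, subr0, normr0, addr0).
have -> : \sum_v d v * z v = \sum_v d v * z' v + m * vol T.
  rewrite vol_indicator mulr_sumr -big_split; apply: eq_bigr => v _ /=.
  rewrite /z'; ring.
by rewrite mulrDr mulrCA lerD // ler_wpM2l ?(ltW m0) //; exact: cut.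
Qed.

(** * Admissible cuts and the conductance minimum *)

Definition admissible mu S : Prop :=
  [/\ balanced G mu S, 0 < vol S & 0 < vol (~: S)%SET].

(** There are finitely many sets, so the minimum is attained and [mu_conductance] is not the default
    value of [set_min]. *)
Lemma mu_conductance_min mu : (exists S, admissible mu S) ->
  exists S, [/\ admissible mu S, mu_conductance G mu = conductance G S &
    forall T, admissible mu T -> mu_conductance G mu <= conductance G T].
Proof.
move=> [S0 /asboolP adm0].
case: (arg_minP (conductance G) (P := fun S => `[< admissible mu S >]) adm0).
move=> S /asboolP admS minS.
have E : mu_conductance G mu = conductance G S.
  apply: set_minE; split; first by exists S.
  by move=> _ [T admT <-]; apply: minS; exact/asboolP.
by exists S; split => // T admT; rewrite E; apply: minS; exact/asboolP.
Qed.

Lemma admissible0 mu S : 0 <= mu -> 0 < volG -> admissible mu S ->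
  admissible 0 S.
Proof.
move=> mu0 V0 [[_ h] S0 S'0]; split => //; split; first by rewrite mul0r ltW.
by apply: (le_trans h); rewrite ler_pM2r // subr0 gerBl.
Qed.

(** For positive [mu], balance forces both sides to have positive volume. For [mu = 0] a balanced
    set may be trivial, so a singleton of positive degree is taken; as there are no loops, its
    complement contains a neighbour of positive degree. *)
Lemma exists_admissible mu : 0 < volG -> 0 <= mu -> mu <= 2^-1 ->
  (exists S, balanced G mu S) -> exists S, admissible mu S.
Proof.
move=> V0; rewrite le_eqVlt => /predU1P[<- _ _|mu0 mu1 [S balS]]; last first.
  have [h1 h2] := balS; have VS := vol_setC S.
  have h : 0 < mu * volG by rewrite mulr_gt0.
  exists S; split => //; lra.
have [v dv] : exists v, 0 < d v.
  apply/existsP; apply: contraTT V0; rewrite negb_exists => /forallP dv.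
  rewrite -leNgt /Defs.volG /Defs.vol big1 // => v _; apply/eqP.
  by rewrite eq_le degree_ge0 andbT leNgt dv.
have [u wvu] : exists u, 0 < w v u.
  apply/existsP; apply: contraTT dv; rewrite negb_exists => /forallP wv.
  by rewrite -leNgt; apply: sumr_le0 => u _; rewrite leNgt wv.
have uv : u != v.
  apply: contraTneq wvu => ->.
  by rewrite weight_nedge ?ltxx // edge_irrefl.
have du : 0 < d u.
  by apply: lt_le_trans wvu _; rewrite weight_sym weight_le_degree.
have vS : 0 < vol [set v]%SET by rewrite /Defs.vol big_set1.
have vS' : 0 < vol (~: [set v])%SET.
  apply: lt_le_trans du _; have := @vol_subset [set u]%SET (~: [set v])%SET.
  by rewrite {1}/Defs.vol big_set1; apply; rewrite finset.sub1set !inE.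
exists [set v]%SET; split => //; split; first by rewrite mul0r ltW.
rewrite subr0 mul1r -(vol_setC [set v]%SET); lra.
Qed.

Lemma mu_conductance_ge0 mu : (exists S, admissible mu S) ->
  0 <= mu_conductance G mu.
Proof.
move=> /mu_conductance_min[S [_ -> _]].
by rewrite divr_ge0 ?boundary_ge0 // le_min !vol_ge0.
Qed.

Lemma mu_conductance_mono mu : 0 <= mu -> 0 < volG ->
  (exists S, admissible mu S) -> mu_conductance G 0 <= mu_conductance G mu.
Proof.
move=> mu0 V0 /mu_conductance_min[S [admS -> _]].
have adm0 := admissible0 mu0 V0 admS.
by have [_ [_ _]] := mu_conductance_min (ex_intro _ S adm0); apply.
Qed.

(** The smaller side of the cut is [T], so [vol T] is the denominator of its conductance. This
    supplies the hypothesis of [layer_cake], both for [mu] and for 0. *)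
Lemma boundary_ge mu T : 0 <= mu -> mu <= 2^-1 ->
  (exists S, admissible mu S) ->
  mu * volG <= vol T -> vol T <= volG / 2 ->
  mu_conductance G mu * vol T <= boundary T.
Proof.
move=> mu0 mu1 ex h1 h2.
have := vol_ge0 T; rewrite le_eqVlt => /predU1P[<-|T0].
  by rewrite mulr0 boundary_ge0.
have VT := vol_setC T.
have V0 : 0 <= volG by exact: vol_ge0.
have adm : admissible mu T.
  split; [split => //|by []|lra].
  by apply: (le_trans h2); nra.
have [_ [_ _ /(_ _ adm)]] := mu_conductance_min ex.
have TC : vol T <= vol (~: T)%SET by lra.
by rewrite /conductance (min_idPl TC) ler_pdivlMr.
Qed.

(** * Weighted median, signed squares and their layers *)

Lemma weighted_median x : 0 < volG -> volG / 2 <= vol [set v | 0 <= x v]%SET ->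
  exists v, [/\ 0 <= x v, vol [set u | x v < x u]%SET <= volG / 2 &
    vol [set u | x u < x v]%SET <= volG / 2].
Proof.
move=> V0.
have attained T : volG / 2 <= vol T -> exists v, v \in T /\
    {in T, forall u, x v <= x u}.
  move=> VT; have [T0|[v0 v0T]] := set_0Vmem T.
    by move: VT; rewrite T0 vol_set0; lra.
  by case: (arg_minP x v0T) => v vT vmin; exists v.
(* The median is the largest value satisfying [P]: if the set strictly above it had half the volume,
   the least value on that set would be a larger candidate. *)
pose P v := volG / 2 <= vol [set u | x v <= x u]%SET.
move=> h; have [v0 [+ v0min]] := attained _ h; rewrite inE => xv0.
have Pv0 : P v0.
  apply: le_trans h _; apply: vol_subset; apply/fintype.subsetP => u uP.
  by rewrite inE v0min.
case: (arg_maxP x Pv0) => v Pv vmax; exists v; split.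
- by apply: le_trans xv0 (vmax _ Pv0).
- rewrite leNgt; apply/negP => /ltW big.
  have [v' [v'T v'min]] := attained _ big.
  have le_v' : x v' <= x v.
    apply: vmax; apply: le_trans big _; apply: vol_subset.
    apply/fintype.subsetP => u uT.
    by rewrite inE v'min.
  by move: v'T; rewrite inE ltNge le_v'.
- move: Pv; rewrite /P -(vol_setC [set u | x u < x v]%SET).
  have -> : (~: [set u | x u < x v])%SET = [set u | x v <= x u]%SET.
    by apply/finset.setP => u; rewrite !inE -leNgt.
  lra.
Qed.

(** Cauchy-Schwarz in additive form, proved edge by edge with [K] as free parameter; the vertex sum
    is first spread over the edges by [degree_sum_sym]. *)
Lemma total_variation_signed_sqr K y : 0 <= K ->
  K * total_variation (fun v => y v * `|y v|) <=
    qform L y + K ^+ 2 / 2 * \sum_v d v * y v ^+ 2.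
Proof.
move=> K0; rewrite laplacian_qform /total_variation.
have -> : K ^+ 2 / 2 * \sum_v d v * y v ^+ 2 =
    2^-1 * \sum_u \sum_v w u v * (K ^+ 2 / 2 * (y u ^+ 2 + y v ^+ 2)).
  transitivity (2^-1 * (K ^+ 2 / 2 *
      \sum_u \sum_v w u v * (y u ^+ 2 + y v ^+ 2))).
    by rewrite (degree_sum_sym (fun v => y v ^+ 2)); field.
  congr (_ * _); rewrite mulr_sumr; apply: eq_bigr => u _.
  by rewrite mulr_sumr; apply: eq_bigr => v _; rewrite mulrCA.
rewrite mulrCA -mulrDr ler_pM2l ?invr_gt0 // mulr_sumr -big_split.
apply: ler_sum => u _; rewrite mulr_sumr -big_split; apply: ler_sum => v _ /=.
rewrite mulrCA -mulrDr ler_wpM2l ?weight_ge0 //.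
set a := y u; set b := y v.
have step : `|a * `|a| - b * `|b| | <= `|a - b| * (`|a| + `|b|).
  (* A product rule for differences; each of its two products is at most [|a - b| (|a| + |b|)] in
     modulus. *)
  have -> : a * `|a| - b * `|b| =
      2^-1 * ((a - b) * (`|a| + `|b|) + (a + b) * (`|a| - `|b|)) by field.
  have h : `|(a + b) * (`|a| - `|b|)| <= `|a - b| * (`|a| + `|b|).
    rewrite normrM [leRHS]mulrC ler_pM ?ler_normD //.
    exact: ler_dist_dist.
  have h' : `|(a - b) * (`|a| + `|b|)| = `|a - b| * (`|a| + `|b|).
    by rewrite normrM (ger0_norm (addr_ge0 (normr_ge0 a) (normr_ge0 b))).
  rewrite normrM ger0_norm ?invr_ge0 // ler_pdivrMl //.
  by apply: le_trans (ler_normD _ _) _; rewrite h'; lra.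
apply: le_trans (ler_wpM2l K0 step) _.
have -> : (a - b) ^+ 2 = `|a - b| ^+ 2 by rewrite real_normK ?num_real.
have -> : a ^+ 2 = `|a| ^+ 2 by rewrite real_normK ?num_real.
have -> : b ^+ 2 = `|b| ^+ 2 by rewrite real_normK ?num_real.
(* AM-GM on the factors [|a - b|] and [K (|a| + |b|) / 2] *)
have := sqr_ge0 (`|a - b| - K / 2 * (`|a| + `|b|)).
have := sqr_ge0 (K * (`|a| - `|b|)).
nra.
Qed.

(** The layers above 0, between [-M] and 0, and below [-M] are monotone functions of [z], and the
    first minus the other two is [z]. Hence on every edge their absolute differences add up to that
    of [z]. *)
Lemma total_variation_split z M : 0 <= M ->
  total_variation (fun v => Num.max (z v) 0) +
  (total_variation (fun v => Num.min (Num.max (- z v) 0) M) +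
   total_variation (fun v => Num.max (- z v - M) 0)) <= total_variation z.
Proof.
move=> M0; rewrite /total_variation -!mulrDr ler_pM2l ?invr_gt0 //.
rewrite -!big_split; apply: ler_sum => u _ /=.
rewrite -!big_split; apply: ler_sum => v _ /=.
rewrite -!mulrDr ler_wpM2l ?weight_ge0 //.
wlog: u v / z u <= z v.
  move=> H; have [|/ltW] := leP (z u) (z v); first exact: H.
  by move/H; rewrite (distrC (z v)) (distrC (Num.max (z v) 0))
    (distrC (Num.min (Num.max (- z v) 0) M)) (distrC (Num.max (- z v - M) 0)).
move=> zuv; rewrite (distrC (z u)) (ger0_norm (x := z v - z u)) ?subr_ge0 //.
set a := z u in zuv *; set b := z v in zuv *.
rewrite (distrC (Num.max a 0)).
have h1 : 0 <= Num.max b 0 - Num.max a 0.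
  by case: (leP a 0); case: (leP b 0); lra.
have h2 : 0 <= Num.min (Num.max (- a) 0) M - Num.min (Num.max (- b) 0) M.
  have : Num.max (- b) 0 <= Num.max (- a) 0.
    by case: (leP (- a) 0); case: (leP (- b) 0); lra.
  move: (Num.max (- a) 0) (Num.max (- b) 0) => p q.
  by case: (leP p M); case: (leP q M); lra.
have h3 : 0 <= Num.max (- a - M) 0 - Num.max (- b - M) 0.
  by case: (leP (- a - M) 0); case: (leP (- b - M) 0); lra.
rewrite !ger0_norm //.
have E c : Num.max c 0 - Num.min (Num.max (- c) 0) M - Num.max (- c - M) 0 = c.
  have [c0|c0] := leP c 0.
    rewrite (max_l (x := - c)) ?oppr_ge0 //; have [cM|cM] := leP (- c) M.
      by rewrite max_r ?subr_le0 //; ring.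
    by rewrite max_l ?subr_ge0 ?ltW //; ring.
  by rewrite max_r ?oppr_le0 ?ltW // (min_l M0) max_r; [ring|lra].
have := E a; have := E b; lra.
Qed.

Lemma signed_sqr_gt0 (a : R) : (0 < a * `|a|) = (0 < a).
Proof.
have [a0|a0|<-] := ltgtP 0 a; last by rewrite mul0r ltxx.
  by rewrite gtr0_norm // mulr_gt0.
by rewrite ltr0_norm // mulrN oppr_gt0 ltNge mulr_le0 // ltW.
Qed.

Lemma signed_sqr_lt0 (a : R) : (a * `|a| < 0) = (a < 0).
Proof. by have := signed_sqr_gt0 (- a); rewrite normrN mulNr !oppr_gt0. Qed.

(** [layer_cake] is applied to each layer of the signed square. Nonempty superlevel sets of the
    middle layer, at levels below [m ^+ 2], contain [S], so they are cut with [phi_mu]; the outer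
    layers are cut with [phi_0]. *)
Lemma total_variation_ge mu y m S : 0 <= mu -> mu <= 2^-1 -> 0 < volG ->
  (exists S, admissible mu S) ->
  vol [set v | 0 < y v]%SET <= volG / 2 ->
  vol [set v | y v < 0]%SET <= volG / 2 ->
  0 <= m -> mu * volG <= vol S -> {in S, forall v, y v <= - m} ->
  mu_conductance G 0 * \sum_v d v * y v ^+ 2 +
  (mu_conductance G mu - mu_conductance G 0) * (m ^+ 2 * (mu * volG))
  <= total_variation (fun v => y v * `|y v|).
Proof.
move=> mu0 mu1 V0 ex Vpos Vneg m0 VS Sm.
have ex0 : exists S, admissible 0 S.
  by have [T admT] := ex; exists T; exact: admissible0 admT.
have mono := mu_conductance_mono mu0 V0 ex.
pose z v := y v * `|y v|; set M := m ^+ 2.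
have M0 : 0 <= M by exact: sqr_ge0.
apply: le_trans (total_variation_split z M0).
pose z1 v := Num.max (z v) 0.
pose z2 v := Num.min (Num.max (- z v) 0) M.
pose z3 v := Num.max (- z v - M) 0.
have sum_z : \sum_v d v * y v ^+ 2 =
    \sum_v d v * z1 v + (\sum_v d v * z2 v + \sum_v d v * z3 v).
  rewrite -!big_split; apply: eq_bigr => v _ /=; rewrite -!mulrDr.
  congr (_ * _); rewrite /z1 /z2 /z3 /z; have [y0|y0] := leP 0 (y v).
    rewrite ger0_norm // -expr2 max_l ?sqr_ge0 // max_r ?oppr_le0 ?sqr_ge0 //.
    rewrite min_l // max_r ?addr0 //; have := sqr_ge0 (y v); lra.
  rewrite ltr0_norm // mulrN opprK -expr2 max_r ?oppr_le0 ?sqr_ge0 // add0r.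
  rewrite max_l ?sqr_ge0 //; have [yM|yM] := leP (y v ^+ 2) M.
    by rewrite max_r ?subr_le0 ?addr0.
  by rewrite max_l ?subr_ge0 ?(ltW yM) // addrC subrK.
(* On [S] the middle layer is saturated at [M]. *)
have sum_z2 : M * (mu * volG) <= \sum_v d v * z2 v.
  apply: (@le_trans _ _ (M * vol S)); first exact: ler_wpM2l.
  rewrite vol_indicator mulr_sumr; apply: ler_sum => v _.
  rewrite mulrCA ler_wpM2l ?degree_ge0 // /z2.
  have [vS|_] := boolP (v \in S); last first.
    by rewrite mulr0 le_min M0 le_max lexx orbT.
  rewrite mulr1 le_min lexx andbT le_max; apply/orP; left.
  have ym := Sm _ vS; have y0 : y v <= 0 by lra.
  by rewrite /z ler0_norm // mulrN opprK -expr2 -sqrrN ler_sqr ?nnegrE; lra.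
have lev0 T : vol T <= volG / 2 ->
    mu_conductance G 0 * vol T <= boundary T.
  by move=> VT; apply: boundary_ge; rewrite ?mul0r ?vol_ge0 ?invr_ge0.
have e1 : mu_conductance G 0 * (\sum_v d v * z1 v) <= total_variation z1.
  apply: layer_cake => [v|t t0]; first by rewrite /z1 le_max lexx orbT.
  apply: lev0; apply: le_trans Vpos; apply: vol_subset.
  apply/fintype.subsetP => v; rewrite !inE /z1 lt_max !ltNge t0 orbF -!ltNge.
  by move=> tz; rewrite -signed_sqr_gt0; exact: le_lt_trans tz.
have neg v t : 0 <= t -> t < - z v -> y v < 0.
  by move=> t0 tz; rewrite -signed_sqr_lt0 -/(z v); lra.
have e3 : mu_conductance G 0 * (\sum_v d v * z3 v) <= total_variation z3.
  apply: layer_cake => [v|t t0]; first by rewrite /z3 le_max lexx orbT.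
  apply: lev0; apply: le_trans Vneg; apply: vol_subset.
  apply/fintype.subsetP => v; rewrite !inE /z3 lt_max !ltNge t0 orbF -!ltNge.
  by move=> tz; apply: (neg v t) => //; lra.
have e2 : mu_conductance G mu * (\sum_v d v * z2 v) <= total_variation z2.
  apply: layer_cake => [v|t t0].
    by rewrite /z2 le_min M0 le_max lexx orbT.
  have [Mt|tM] := leP M t.
    have -> : [set v | t < z2 v]%SET = finset.set0.
      apply/finset.setP => v; rewrite !inE /z2 lt_min [t < M]ltNge Mt.
      by rewrite andbF.
    by rewrite vol_set0 mulr0 boundary_ge0.
  apply: boundary_ge => //.
    apply: le_trans VS _; apply: vol_subset; apply/fintype.subsetP => v vS.
    rewrite inE lt_min tM andbT; apply: (lt_le_trans tM).
    rewrite le_max; apply/orP; left.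
    have ym := Sm _ vS; have y0 : y v <= 0 by lra.
    by rewrite /z ler0_norm // mulrN opprK -expr2 -sqrrN ler_sqr ?nnegrE; lra.
  apply: le_trans Vneg; apply: vol_subset; apply/fintype.subsetP => v.
  rewrite !inE lt_min lt_max [t < 0]ltNge t0 orbF => /andP[tz _].
  exact: neg tz.
rewrite sum_z; apply: le_trans (lerD e1 (lerD e2 e3)).
(* As [phi_mu >= phi_0], the mass of the middle layer may be replaced by its lower bound. *)
have : 0 <= (mu_conductance G mu - mu_conductance G 0) *
    (\sum_v d v * z2 v - M * (mu * volG)) by rewrite mulr_ge0 ?subr_ge0.
lra.
Qed.

(* The ratio of the right-hand side to the left-hand side increases with [c] on
   [a, b], and it equals 1 at [c = a]. *)
Lemma median_gap mu (a b c v : R) : 0 < mu -> mu <= 2^-1 -> 0 < v ->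
  0 <= a -> a ^+ 2 = mu / ((1 - mu) * v) ->
  0 <= b -> b ^+ 2 = (1 - mu) / (mu * v) -> a <= c -> c <= b ->
  4 * mu ^+ 2 * (1 + c ^+ 2 * v) <= (a + c) ^+ 2 * (mu * v).
Proof.
move=> mu0 mu1 v0 a0 aE b0 bE ac cb.
have nu0 : 0 < 1 - mu by lra.
(* This is both [a / b] and [a ^+ 2 * v]; in terms of [r] the claim becomes homogeneous in [a] and
   [c]. *)
pose r := mu / (1 - mu).
have r0 : 0 < r by rewrite divr_gt0.
have r1 : r <= 1 by rewrite ler_pdivrMr //; lra.
have aV : a ^+ 2 * v = r by rewrite aE /r; field; rewrite !gt_eqF.
have muE : mu = r / (1 + r).
  by rewrite /r; field; rewrite !gt_eqF //; lra.
have abE : a = r * b.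
  have rb : 0 <= r * b by rewrite mulr_ge0 // ltW.
  apply: (@pexpIrn _ 2); rewrite ?nnegrE //=.
  by rewrite exprMn aE bE /r; field; rewrite !gt_eqF.
have rc : r * c <= a by rewrite abE ler_wpM2l // ltW.
(* The difference of the two sides, up to a positive factor. The second factor equals
   [(c - r * a) + 3 * (a - r * c)]. *)
have main : 0 <= (c - a) * (c * (1 - 3 * r) + a * (3 - r)).
  rewrite mulr_ge0 ?subr_ge0 //.
  have : r * a <= c by apply: le_trans ac; rewrite ler_piMl.
  lra.
have -> : 4 * mu ^+ 2 * (1 + c ^+ 2 * v) =
   (mu / (1 + r)) * v * (4 * a ^+ 2 * (1 + c ^+ 2 * v)).
  by rewrite expr2 {2}muE -{1}aV; ring.
have -> : (a + c) ^+ 2 * (mu * v) =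
   (mu / (1 + r)) * v * ((a + c) ^+ 2 * (1 + r)).
  by field; rewrite gt_eqF //; lra.
have r1p : 0 < 1 + r by lra.
rewrite ler_pM2l; last by rewrite mulr_gt0 // divr_gt0.
rewrite -subr_ge0; apply: le_trans main _.
have -> : 4 * a ^+ 2 * (1 + c ^+ 2 * v) =
   4 * a ^+ 2 + 4 * c ^+ 2 * (a ^+ 2 * v).
  by ring.
by rewrite aV; lra.
Qed.

(** * Feasible vectors and the lower bound on their energy *)

Lemma le_norm_inf x v : `|x v| <= norm_inf x.
Proof. exact: le_bigmax. Qed.

Lemma norm_inf_le x (B : R) : 0 <= B -> (forall v, `|x v| <= B) ->
  norm_inf x <= B.
Proof. by move=> B0 xB; apply: bigmax_le. Qed.

Lemma feasible_opp mu x : feasible G mu x -> feasible G mu (fun v => - x v).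
Proof.
move=> [x1 x2 x3 x4]; split => [|||v]; last by rewrite normrN.
- by under eq_bigr do rewrite mulNr; rewrite sumrN x1 oppr0.
- rewrite -x2 !degree_mx_qform; by under eq_bigr do rewrite sqrrN.
- move=> mu0; apply: norm_inf_le => [|v]; first exact: sqrtr_ge0.
  by rewrite normrN; apply: le_trans (x3 mu0); exact: le_norm_inf.
Qed.

Lemma laplacian_qform_opp x : qform L (fun v => - x v) = qform L x.
Proof.
rewrite !laplacian_qform; congr (_ * _); apply: eq_bigr => u _.
by apply: eq_bigr => v _; rewrite -opprD sqrrN.
Qed.

Lemma laplacian_qform_shift x c : qform L (fun v => x v - c) = qform L x.
Proof.
rewrite !laplacian_qform; congr (_ * _); apply: eq_bigr => u _.
by apply: eq_bigr => v _; rewrite opprB addrA subrK.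
Qed.

Lemma feasible_vol_neg mu x : 0 <= mu -> mu <= 2^-1 -> 0 < volG ->
  feasible G mu x -> mu * volG <= vol [set v | x v < 0]%SET.
Proof.
rewrite le_eqVlt => /predU1P[<- _ _ _|mu0 mu1 V0 [x1 _ x3 x4]].
  by rewrite mul0r vol_ge0.
set N := [set v | x v < 0]%SET.
have nu0 : 0 < 1 - mu by lra.
set a := Num.sqrt (mu / ((1 - mu) * volG)) in x4.
set b := Num.sqrt ((1 - mu) / (mu * volG)) in x3.
have b0 : 0 < b by rewrite sqrtr_gt0 divr_gt0 // mulr_gt0.
have abE : a * (1 - mu) = mu * b.
  apply: (@pexpIrn _ 2); rewrite ?nnegrE ?mulr_ge0 ?sqrtr_ge0 ?(ltW mu0)
    ?(ltW nu0) //=.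
  rewrite !exprMn !sqr_sqrtr ?divr_ge0 ?mulr_ge0 ?(ltW mu0) ?(ltW nu0)
    ?(ltW V0) //.
  by field; rewrite !gt_eqF.
(* Entrywise [x >= a] off [N] and [x >= - b] on [N]; summing against the degrees gives 0 on the
   right. *)
have : a * vol (~: N)%SET - b * vol N <= 0.
  rewrite -x1 !vol_indicator !mulr_sumr -sumrB; apply: ler_sum => v _.
  rewrite mulrCA [b * _]mulrCA -mulrBr [leRHS]mulrC ler_wpM2l ?degree_ge0 //.
  have := x4 v; have := le_trans (le_norm_inf x v) (x3 mu0).
  rewrite !inE; have [xv0|xv0] := ltP (x v) 0 => /=.
    by rewrite ltr0_norm //; lra.
  by rewrite ger0_norm //; lra.
have := vol_setC N; move: (vol _) (vol N) => p q <- h.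
have : 0 <= b * (q * (1 - mu) - mu * p).
  have -> : b * (q * (1 - mu) - mu * p) = (1 - mu) * (b * q - a * p).
    by rewrite mulrBr [_ * (mu * p)]mulrA [b * mu]mulrC -abE; ring.
  by rewrite mulr_ge0 ?(ltW nu0) //; lra.
by rewrite pmulr_rge0 //; lra.
Qed.

Lemma feasible_cheeger_nonneg mu x :
  0 <= mu -> mu <= 2^-1 -> 0 < volG -> (exists S, admissible mu S) ->
  feasible G mu x -> volG / 2 <= vol [set v | 0 <= x v]%SET ->
  2^-1 * (mu_conductance G 0 + 4 * mu ^+ 2 *
    (mu_conductance G mu - mu_conductance G 0)) ^+ 2 <= qform L x.
Proof.
move=> mu0 mu1 V0 ex feas half.
set phi0 := mu_conductance G 0; set phimu := mu_conductance G mu.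
have phi00 : 0 <= phi0.
  apply: mu_conductance_ge0; have [T admT] := ex; exists T.
  exact: admissible0 admT.
have mono : phi0 <= phimu by exact: mu_conductance_mono.
set K := phi0 + _.
have K0 : 0 <= K.
  by rewrite addr_ge0 // mulr_ge0 ?subr_ge0 // mulr_ge0 ?sqr_ge0.
have VN := feasible_vol_neg mu0 mu1 V0 feas.
have [x1 x2 x3 x4] := feas; rewrite degree_mx_qform in x2.
have [v0 [c0 Vgt Vlt]] := weighted_median V0 half.
set c := x v0 in c0 Vgt Vlt.
set a := Num.sqrt (mu / ((1 - mu) * volG)) in x4.
have a0 : 0 <= a by exact: sqrtr_ge0.
have ac : a <= c by rewrite (le_trans (x4 v0)) // ger0_norm.
pose y v := x v - c.
pose Y := 1 + c ^+ 2 * volG.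
(* The cross term vanishes by orthogonality to the degrees. *)
have sum_y : \sum_v d v * y v ^+ 2 = Y.
  rewrite /Y -x2 /Defs.volG vol_indicator mulr_sumr.
  transitivity (\sum_v (d v * x v ^+ 2 + c ^+ 2 * (d v * (v \in [set: V]%SET)%:R)
     - 2 * c * (x v * d v))).
    by apply: eq_bigr => v _; rewrite inE mulr1 /y; ring.
  by rewrite sumrB big_split /= -[in X in _ - X]mulr_sumr x1 mulr0 subr0.
have Y1 : 1 <= Y by rewrite lerDl mulr_ge0 ?sqr_ge0 // ltW.
(* The middle layer carries at least the fraction [4 * mu ^+ 2] of the total mass [Y], whence the
   constant in [K]. *)
have gap : 4 * mu ^+ 2 * Y <= (a + c) ^+ 2 * (mu * volG).
  move: mu0; rewrite le_eqVlt => /predU1P[<-|mu0].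
    by rewrite expr2 !(mulr0, mul0r).
  have nu0 : 0 < 1 - mu by lra.
  apply: (@median_gap _ _ (Num.sqrt ((1 - mu) / (mu * volG)))) => //.
  - by rewrite sqr_sqrtr // divr_ge0 ?mulr_ge0 // ltW.
  - exact: sqrtr_ge0.
  - by rewrite sqr_sqrtr // divr_ge0 ?mulr_ge0 // ltW.
  - by apply: le_trans (x3 mu0); rewrite -(ger0_norm c0); exact: le_norm_inf.
have tv : K * Y <= total_variation (fun v => y v * `|y v|).
  have := @total_variation_ge mu y (a + c) [set v | x v < 0]%SET mu0 mu1 V0 ex.
  have -> : [set v | 0 < y v]%SET = [set u | c < x u]%SET.
    by apply/finset.setP => v; rewrite !inE subr_gt0.
  have -> : [set v | y v < 0]%SET = [set u | x u < c]%SET.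
    by apply/finset.setP => v; rewrite !inE subr_lt0.
  rewrite sum_y -/phi0 -/phimu => H; apply: le_trans (H Vgt Vlt _ VN _).
  - have : 0 <= (phimu - phi0) * ((a + c) ^+ 2 * (mu * volG) - 4 * mu ^+ 2 * Y).
      by rewrite mulr_ge0 ?subr_ge0.
    by rewrite /K; lra.
  - by rewrite addr_ge0.
  - by move=> v; rewrite inE => xv; have := x4 v; rewrite ltr0_norm // /y; lra.
(* Together with [tv] this bounds the energy below by [K ^+ 2 / 2 * Y], and [Y >= 1]. *)
have := total_variation_signed_sqr y K0.
rewrite sum_y laplacian_qform_shift.
have := ler_wpM2l K0 tv.
have : 0 <= K ^+ 2 * (Y - 1) by rewrite mulr_ge0 ?sqr_ge0 ?subr_ge0.
lra.
Qed.

Lemma feasible_cheeger mu x :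
  0 <= mu -> mu <= 2^-1 -> 0 < volG -> (exists S, admissible mu S) ->
  feasible G mu x ->
  2^-1 * (mu_conductance G 0 + 4 * mu ^+ 2 *
    (mu_conductance G mu - mu_conductance G 0)) ^+ 2 <= qform L x.
Proof.
move=> mu0 mu1 V0 ex feas.
have [|half] := leP (volG / 2) (vol [set v | 0 <= x v]%SET).
  exact: feasible_cheeger_nonneg.
rewrite -laplacian_qform_opp.
apply: feasible_cheeger_nonneg (feasible_opp feas) _ => //.
have := vol_setC [set v | 0 <= x v]%SET => VE.
suff : vol (~: [set v | 0 <= x v])%SET <= vol [set v | 0 <= - x v]%SET by lra.
apply: vol_subset; apply/fintype.subsetP => v.
by rewrite !inE oppr_ge0 -ltNge => /ltW.
Qed.

(** * Upper bound: the vector of a cut *)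

Lemma cut_vector mu S : 0 <= mu -> mu <= 2^-1 -> 0 < volG ->
  admissible mu S ->
  exists2 x, feasible G mu x & qform L x <= 2 * conductance G S.
Proof.
move=> mu0 mu1 V0 [[h1 h2] s0 s'0].
have VS := vol_setC S.
set s := vol S in h1 h2 s0 VS *; set s' := vol (~: S)%SET in s'0 VS *.
have nu0 : 0 < 1 - mu by lra.
(* The vector is [k * s'] on [S] and [- k * s] elsewhere; [k] normalises its degree-weighted square
   sum [k ^+ 2 * s * s' * volG]. *)
pose k := Num.sqrt (s * s' * volG)^-1.
have k0 : 0 <= k by exact: sqrtr_ge0.
have k2 : k ^+ 2 = (s * s' * volG)^-1.
  by rewrite sqr_sqrtr // invr_ge0 !mulr_ge0 // ltW.
pose x v := k * (volG * (v \in S)%:R - s).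
have sum_affine (p q : R) :
    \sum_v d v * (p * (v \in S)%:R + q) = p * s + q * volG.
  rewrite /s /Defs.volG !vol_indicator !mulr_sumr -big_split.
  by apply: eq_bigr => v _; rewrite /= inE mulr1; ring.
have absx v : `|x v| = Num.sqrt (if v \in S then s' / (s * volG)
                                           else s / (s' * volG)).
  rewrite -sqrtr_sqr; congr Num.sqrt; rewrite /x exprMn k2.
  case: (v \in S); rewrite /= ?mulr1 ?mulr0.
    have -> : volG - s = s' by lra.
    by field; rewrite !gt_eqF.
  by rewrite sub0r sqrrN; field; rewrite !gt_eqF.
exists x.
  split => [|||v].
  - transitivity (\sum_v d v * (k * volG * (v \in S)%:R + - (k * s))).
      by apply: eq_bigr => v _; rewrite /x; ring.
    by rewrite sum_affine; ring.
  - rewrite degree_mx_qform; transitivity (\sum_v d v *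
      (k ^+ 2 * (volG ^+ 2 - 2 * volG * s) * (v \in S)%:R + k ^+ 2 * s ^+ 2)).
      apply: eq_bigr => v _; rewrite /x.
      by case: (v \in S); rewrite /= ?mulr1 ?mulr0; ring.
    by rewrite sum_affine k2 -VS; field; rewrite VS !gt_eqF.
  - move=> {}mu0; apply: norm_inf_le => [|v]; first exact: sqrtr_ge0.
    rewrite absx ler_wsqrtr //.
    by case: ifP => _; rewrite ler_pdivrMr ?mulr_gt0 // mulrAC
      ler_pdivlMr ?mulr_gt0 //; nra.
  - rewrite absx ler_wsqrtr //.
    by case: ifP => _; rewrite ler_pdivrMr ?mulr_gt0 // mulrAC
      ler_pdivlMr ?mulr_gt0 //; nra.
have -> : qform L x = volG / (s * s') * boundary S.
  rewrite laplacian_qform boundaryE /total_variation [RHS]mulrCA; congr (_ * _).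
  rewrite mulr_sumr; apply: eq_bigr => u _; rewrite mulr_sumr.
  apply: eq_bigr => v _; rewrite [RHS]mulrCA; congr (_ * _).
  have -> : x u - x v = k * volG * ((u \in S)%:R - (v \in S)%:R).
    by rewrite /x; ring.
  rewrite !exprMn k2.
  have -> : volG / (s * s') = (s * s' * volG)^-1 * volG ^+ 2.
    by field; rewrite !gt_eqF.
  congr (_ * _).
  by case: (u \in S); case: (v \in S);
    rewrite /= ?subrr ?subr0 ?sub0r ?sqrrN ?normrN ?normr0 ?normr1 ?expr0n
      ?expr1n.
rewrite /conductance -/s -/s' mulrCA [leLHS]mulrC ler_wpM2l ?boundary_ge0 //.
(* It remains to use that [volG = s + s'] is at most twice the larger volume. *)
have [ss'|ss'] := leP s s'.
  rewrite ler_pdivrMr ?mulr_gt0 // mulrA mulfVK ?gt_eqF //; lra.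
rewrite ler_pdivrMr ?mulr_gt0 // [s * s']mulrC mulrA mulfVK ?gt_eqF //; lra.
Qed.

End Cheeger.

(** * Attainment of the minimum defining [lambda] *)

Section Compactness.
Import ArrowAsProduct numFieldNormedType.Exports.
Local Open Scope classical_set_scope.
Variables (R : realType) (V : finType).
Implicit Types (f g : (V -> R) -> R) (x : V -> R).

Lemma continuous_eval (v : V) : continuous (fun x : V -> R => x v).
Proof. exact: (@proj_continuous V (fun=> R) v). Qed.

Lemma continuous_sum (I : finType) (F : I -> (V -> R) -> R) :
  (forall i, continuous (F i)) -> continuous (fun x => \sum_i F i x).
Proof. by move=> cF; apply: continuous_big => // x; exact: add_continuous. Qed.

Lemma continuous_mul f g : continuous f -> continuous g ->
  continuous (fun x => f x * g x).
Proof. by move=> cf cg x; exact: (continuousM (cf x) (cg x)). Qed.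

Lemma continuous_qform (N : V -> V -> R) : continuous (qform N).
Proof.
apply: continuous_sum => u; apply: continuous_sum => v.
apply: continuous_mul; last exact: continuous_eval.
by apply: continuous_mul;
  [exact: continuous_eval|move=> x; exact: cst_continuous].
Qed.

Lemma closed_preimage f (D : set R) :
  continuous f -> closed D -> closed (f @^-1` D).
Proof. by move=> cf; apply: preimage_closed => x _; exact: cf. Qed.

Lemma closed_feasible (G : wgraph R V) mu : closed (feasible G mu).
Proof.
have -> : feasible G mu =
    ((fun x => \sum_v x v * degree G v) @^-1` [set t | t = 0]) `&`
    (qform (degree_mx G) @^-1` [set t | t = 1]) `&`
    (* The index set is all of [V] or empty according to the guard [0 < mu]. *)
    (\bigcap_(v in [set v | 0 < mu]) ((fun x : V -> R => `|x v|) @^-1`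
       [set t | t <= Num.sqrt ((1 - mu) / (mu * volG G))])) `&`
    (\bigcap_v ((fun x : V -> R => `|x v|) @^-1`
       [set t | Num.sqrt (mu / ((1 - mu) * volG G)) <= t])).
  apply/seteqP; split=> x /=.
    move=> [x1 x2 x3 x4]; split; [split; [by []|]|] => v /=; last by [].
    by move=> mu0; apply: le_trans (x3 mu0); exact: le_norm_inf.
  move=> [[[x1 x2] x3] x4]; split => // [mu0|v]; last exact: x4.
  by apply: norm_inf_le => [|v]; [exact: sqrtr_ge0|exact: x3].
have cabs v : continuous (fun x : V -> R => `|x v|).
  move=> x; apply: (@continuous_comp _ _ _ (fun x : V -> R => x v) Num.norm).
    exact: continuous_eval.
  exact: norm_continuous.
apply: closedI; first apply: closedI; first apply: closedI.
- apply: closed_preimage; last exact: closed_eq.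
  apply: continuous_sum => v; apply: continuous_mul.
    exact: continuous_eval.
  by move=> x; exact: cst_continuous.
- by apply: closed_preimage; [exact: continuous_qform|exact: closed_eq].
- by apply: closed_bigI => v _; apply: closed_preimage; last exact: closed_le.
- by apply: closed_bigI => v _; apply: closed_preimage; last exact: closed_ge.
Qed.

(** [A] is a closed subset of a product of segments, compact by Tychonoff, so the extreme value
    theorem applies. *)
Lemma attains_min (A : set (V -> R)) f (B : V -> R) :
  closed A -> continuous f -> A !=set0 -> (forall x v, A x -> `|x v| <= B v) ->
  exists2 x, A x & forall y, A y -> f x <= f y.
Proof.
move=> cA cf A0 AB.
have compA : compact A.
  have cbox := @tychonoff V (fun=> R) (fun v => `[- B v, B v])
    (fun v => @segment_compact R _ _).
  apply: subclosed_compact cA cbox _ => x Ax v /=.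
  by rewrite in_itv /= -ler_norml; exact: AB.
have [x xA xmin] := compact_EVT_min A0 compA (continuous_subspaceT cf).
by exists x => [|y yA]; [exact: set_mem|apply: xmin; exact: mem_set].
Qed.

(* Isolated vertices are irrelevant for the energy but make the feasible set
   unbounded when [mu = 0]; moving them to the least admissible modulus
   restores compactness. *)
Lemma feasible_min (G : wgraph R V) mu : 0 <= mu -> mu <= 2^-1 ->
  0 < volG G -> (exists x, feasible G mu x) ->
  exists2 x, feasible G mu x &
    forall y, feasible G mu y -> qform (laplacian G) x <= qform (laplacian G) y.
Proof.
move=> mu0 mu1 V0 [x0 feas0].
have nu0 : 0 < 1 - mu by lra.
set a := Num.sqrt (mu / ((1 - mu) * volG G)).
have a0 : 0 <= a by exact: sqrtr_ge0.
pose clamp x v := if degree G v == 0 then a else x v.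
have clamp_feas x : feasible G mu x -> feasible G mu (clamp x).
  move=> [x1 x2 x3 x4]; split => [||mupos|v].
  - rewrite -[RHS]x1; apply: eq_bigr => v _; rewrite /clamp.
    by case: eqP => // ->; rewrite !mulr0.
  - rewrite -[RHS]x2 !degree_mx_qform; apply: eq_bigr => v _; rewrite /clamp.
    by case: eqP => // ->; rewrite !mul0r.
  - apply: norm_inf_le => [|v]; first exact: sqrtr_ge0.
    rewrite /clamp; case: eqP => _; last first.
      by apply: le_trans (x3 mupos); exact: le_norm_inf.
    rewrite ger0_norm // ler_wsqrtr // ler_pdivrMr ?mulr_gt0 // mulrAC.
    by rewrite ler_pdivlMr ?mulr_gt0 //; nra.
  - by rewrite /clamp; case: eqP => _; [rewrite ger0_norm|exact: x4].
have clampE x : qform (laplacian G) (clamp x) = qform (laplacian G) x.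
  rewrite !laplacian_qform; congr (_ * _).
  apply: eq_bigr => u _; apply: eq_bigr => v _; rewrite /clamp.
  have w0 p q : degree G p = 0 -> weight G p q = 0.
    move=> dp; apply/eqP; rewrite eq_le weight_ge0 andbT -dp.
    exact: weight_le_degree.
  case: eqP => [/w0 ->|_]; first by rewrite !mul0r.
  by case: eqP => // /w0 wv; rewrite (weight_sym G u v) wv !mul0r.
pose A := feasible G mu `&` \bigcap_(v in [set v | degree G v = 0])
  ((fun x : V -> R => x v) @^-1` [set t | t = a]).
have [||||x [feas _] xmin] :=
  (* One bound for both kinds of vertices: at degree 0 the entry is [a] and the inverse is 0;
     otherwise normalisation gives [x v ^+ 2 <= (degree G v)^-1], and [|t| <= 1 + t ^+ 2]. *)
  @attains_min A (qform (laplacian G)) (fun v => a + 1 + (degree G v)^-1).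
- apply: closedI; first exact: closed_feasible.
  apply: closed_bigI => v _.
  by apply: closed_preimage; [exact: continuous_eval|exact: closed_eq].
- exact: continuous_qform.
- exists (clamp x0); split; first exact: clamp_feas.
  by move=> v /= dv; rewrite /clamp dv eqxx.
- move=> x v [[_ + _ _] xa]; rewrite degree_mx_qform => x2.
  have := degree_ge0 G v; rewrite le_eqVlt => /predU1P[dv|dv].
    by rewrite (xa v) /= -?dv // ger0_norm // invr0; lra.
  have dx : degree G v * x v ^+ 2 <= 1.
    rewrite -x2 (bigD1 v) //= lerDl; apply: sumr_ge0 => u _.
    by rewrite mulr_ge0 ?sqr_ge0 ?degree_ge0.
  have : x v ^+ 2 <= (degree G v)^-1.
    by rewrite -[leRHS]mul1r ler_pdivlMr // mulrC.
  rewrite -(real_normK (num_real (x v))) => h.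
  have := sqr_ge0 (`|x v| - 1); have := normr_ge0 (x v); nra.
exists x => // y feasy; rewrite -(clampE y); apply: xmin; split.
  exact: clamp_feas.
by move=> v /= dv; rewrite /clamp dv eqxx.
Qed.

End Compactness.

Lemma lambda_min (R : realType) (V : finType) (G : wgraph R V) (mu : R) :
  0 <= mu -> mu <= 2^-1 -> 0 < volG G -> (exists x, feasible G mu x) ->
  exists x, [/\ feasible G mu x, lambda G mu = qform (laplacian G) x &
    forall y, feasible G mu y -> lambda G mu <= qform (laplacian G) y].
Proof.
move=> mu0 mu1 V0 /(feasible_min mu0 mu1 V0)[x feas xmin].
have E : lambda G mu = qform (laplacian G) x.
  apply: set_minE; split; first by exists x.
  by move=> _ [y feasy <-]; exact: xmin.
by exists x; split => // y; rewrite E; exact: xmin.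
Qed.

(** * Assembly of the two bounds *)

Theorem theorem1 (R : realType) (V : finType) (G : wgraph R V) (mu : R)
  (hvol : 0 < volG G) (hmu0 : 0 <= mu) (hmu1 : mu <= 2^-1)
  (hbal : exists S : {set V}, balanced G mu S) :
  let phi_mu := mu_conductance G mu in
  let phi_0 := mu_conductance G 0 in
  lambda G mu <= 2 * phi_mu /\
  2^-1 * Num.max
    (Num.min ((mu / (1 - mu) * phi_mu) ^+ 2)
             (((mu ^+ 2 * phi_mu + (1 - 2 * mu) * phi_0)
                 / (1 - mu - mu ^+ 2)) ^+ 2))
    (phi_0 ^+ 2)
  <= lambda G mu.
Proof.
move=> phi_mu phi_0.
have ex := exists_admissible hvol hmu0 hmu1 hbal.
have ex0 : exists S, admissible G 0 S.
  by have [T admT] := ex; exists T; exact: admissible0 admT.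
have phi00 : 0 <= phi_0 by exact: mu_conductance_ge0.
have mono : phi_0 <= phi_mu by exact: mu_conductance_mono.
have [S [admS phiE _]] := mu_conductance_min ex.
(* The cut vector gives the upper bound and also shows that the feasible set is nonempty. *)
have [y feasy yle] := cut_vector hmu0 hmu1 hvol admS.
have [x [feasx lambdaE lambda_le]] :=
  lambda_min hmu0 hmu1 hvol (ex_intro _ y feasy).
split; first by rewrite /phi_mu phiE (le_trans (lambda_le _ feasy)).
rewrite lambdaE; apply: le_trans (feasible_cheeger hmu0 hmu1 hvol ex feasx).
rewrite ler_pM2l ?invr_gt0 // ge_max ge_min -/phi_0 -/phi_mu.
set K := phi_0 + _.
have mu2 : 0 <= mu ^+ 2 by exact: sqr_ge0.
have phiK : phi_0 <= K.
  by rewrite lerDl mulr_ge0 ?subr_ge0 // mulr_ge0.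
have K0 : 0 <= K by exact: le_trans phiK.
apply/andP; split; last by rewrite ler_sqr ?nnegrE.
have mu_lt : mu ^+ 2 <= mu / 2 by nra.
have den : 0 < 1 - mu - mu ^+ 2 by lra.
have num : 0 <= mu ^+ 2 * phi_mu + (1 - 2 * mu) * phi_0.
  by rewrite addr_ge0 // mulr_ge0 //; lra.
apply/orP; right; rewrite ler_sqr ?nnegrE ?divr_ge0 ?(ltW den) //.
rewrite ler_pdivrMr // -subr_ge0.
have -> : K * (1 - mu - mu ^+ 2) - (mu ^+ 2 * phi_mu + (1 - 2 * mu) * phi_0) =
   mu ^+ 2 * (4 * (1 - mu - mu ^+ 2) - 1) * (phi_mu - phi_0) +
   mu * (1 - 2 * mu) * phi_0 by rewrite /K; ring.
(* The denominator decreases in [mu] and equals 1/4 at [mu = 1/2]. *)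
have c1 : 0 <= 4 * (1 - mu - mu ^+ 2) - 1 by lra.
have c2 : 0 <= 1 - 2 * mu by lra.
by rewrite addr_ge0 // mulr_ge0 ?subr_ge0 // mulr_ge0.
Qed.
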